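(* Let $M$ be a common meadow and $I\neq M$ an ideal of $M$. Then $M/I$ satisfies $\mathsf{CIL}$ (that is, $M/I$ is a common meadow satisfying $\mathsf{CIL}$) if and only if $I$ is a maximal ideal of $M$.
   Context: A common meadow is a set $M$ with constants $0,1,\mathbf{a}$, binary operations $+,\cdot$ and unary operations $-$ and $(\cdot)^{-1}$ such that for all $x,y,z\in M$: $(x+y)+z=x+(y+z)$; $x+y=y+x$; $x+0=x$; $x+(-x)=0\cdot x$; $(x\cdot y)\cdot z=x\cdot(y\cdot z)$; $x\cdot y=y\cdot x$; $1\cdot x=x$; $x\cdot(y+z)=x\cdot y+x\cdot z$; $-(-x)=x$; $x\cdot x^{-1}=1+0\cdot x^{-1}$; $(x\cdot y)^{-1}=x^{-1}\cdot y^{-1}$; $(1+0\cdot x)^{-1}=1+0\cdot x$; $0^{-1}=\mathbf{a}$; $x+\mathbf{a}=\mathbf{a}$. $\mathsf{CIL}$ (Common Inverse Law) is: for all $x$, if $x\neq 0$ and $x\neq\mathbf{a}$ then $x\cdot x^{-1}=1$. $0\cdot M=\{0\cdot x\mid x\in M\}$; for $z\in 0\cdot M$, $M_z=\{x\in M\mid 0\cdot x=z\}$ is a commutative ring with zero $z$ and identity $1+z$. An ideal of $M$ is a subset $I\subseteq M$ with $0\in I$ and $-x,x+y,x\cdot r\in I$ for all $x,y\in I$, $r\in M$. A maximal ideal is an ideal $I\neq M$ not properly contained in any ideal different from $M$. For an ideal $I$ let $K=\{z\in 0\cdot M\mid I\cap M_z=M_z\}$ and $$M/I=\Big(\bigsqcup_{z\in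 0\cdot M\setminus K}M_z/(I\cap M_z)\Big)\sqcup\{\mathbf{a}\},$$ with operations: for $x\in M_z$, $y\in M_{z'}$, $z,z'\notin K$, the sum (product) of $x+I\cap M_z$ and $y+I\cap M_{z'}$ is $(x+y)+(I\cap M_{z\cdot z'})$ (respectively $(x\cdot y)+(I\cap M_{z\cdot z'})$) if $z\cdot z'\notin K$ and $\mathbf{a}$ if $z\cdot z'\in K$; sums and products with $\mathbf{a}$ equal $\mathbf{a}$; $-(x+I\cap M_z)=(-x)+I\cap M_z$, $-\mathbf{a}=\mathbf{a}$; zero and one are $0+I\cap M_0$ and $1+I\cap M_0$. Saying that $M/I$ is a common meadow means that there is a (necessarily unique) inverse operation making it one. *)

(* Defs.v *)
From mathcomp Require Import all_boot.
From mathcomp Require Import boolp classical_sets.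

Set Implicit Arguments.
Unset Strict Implicit.
Unset Printing Implicit Defensive.

Local Open Scope classical_set_scope.

Declare Scope meadow_scope.
Delimit Scope meadow_scope with M.
Local Open Scope meadow_scope.

(* The inverse is kept apart from the other operations because the quotient of
   a common meadow comes with the latter only. *)
Record preMeadow := PreMeadow {
  meadow_sort :> Type;
  mzero : meadow_sort;
  mone : meadow_sort;
  merr : meadow_sort;
  madd : meadow_sort -> meadow_sort -> meadow_sort;
  mmul : meadow_sort -> meadow_sort -> meadow_sort;
  mopp : meadow_sort -> meadow_sort }.

Arguments mzero {p}.
Arguments mone {p}.
Arguments merr {p}.

Notation "0" := mzero : meadow_scope.
Notation "1" := mone : meadow_scope.
Notation "'\a'" := merr (at level 0) : meadow_scope.
Notation "x + y" := (madd x y) : meadow_scope.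
Notation "x * y" := (mmul x y) : meadow_scope.
Notation "- x" := (mopp x) : meadow_scope.

Record is_common_meadow (P : preMeadow) (inv : P -> P) : Prop :=
  IsCommonMeadow {
    cm_addA : forall x y z : P, (x + y) + z = x + (y + z);
    cm_addC : forall x y : P, x + y = y + x;
    cm_addx0 : forall x : P, x + 0 = x;
    cm_addxN : forall x : P, x + (- x) = 0 * x;
    cm_mulA : forall x y z : P, (x * y) * z = x * (y * z);
    cm_mulC : forall x y : P, x * y = y * x;
    cm_mul1x : forall x : P, 1 * x = x;
    cm_mulDr : forall x y z : P, x * (y + z) = x * y + x * z;
    cm_oppK : forall x : P, - (- x) = x;
    cm_mulxV : forall x : P, x * inv x = 1 + 0 * inv x;
    cm_invM : forall x y : P, inv (x * y) = inv x * inv y;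
    cm_inv1D0 : forall x : P, inv (1 + 0 * x) = 1 + 0 * x;
    cm_inv0 : inv 0 = \a;
    cm_addxa : forall x : P, x + \a = \a }.

Record commonMeadow := CommonMeadow {
  cm_pre :> preMeadow;
  cm_inv : cm_pre -> cm_pre;
  cm_axioms : is_common_meadow cm_inv }.

Definition CIL (P : preMeadow) (inv : P -> P) : Prop :=
  forall x : P, x <> 0 -> x <> \a -> x * inv x = 1.

Definition zeros (P : preMeadow) : set P := [set 0 * x | x in [set: P]].

Arguments zeros P : clear implicits.

Definition layer (P : preMeadow) (z : P) : set P := [set x | 0 * x = z].

Record is_ideal (P : preMeadow) (I : set P) : Prop := IsIdeal {
  ideal0 : I 0;
  idealN : forall x : P, I x -> I (- x);
  idealD : forall x y : P, I x -> I y -> I (x + y);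
  idealM : forall x r : P, I x -> I (x * r) }.

Definition is_maximal_ideal (P : preMeadow) (I : set P) : Prop :=
  [/\ is_ideal I, I <> [set: P] &
      forall J : set P, is_ideal J -> J <> [set: P] -> ~ I `<` J].

Section Quotient.
Variables (P : preMeadow) (I : set P).

(* The set K of the zeros whose whole layer is collapsed by I. *)
Definition collapsed : set P :=
  [set z | zeros P z /\ I `&` layer z = layer z].

Definition coset (z x : P) : set P := [set x + i | i in I `&` layer z].

Definition layer_quotient (z : P) : set (set P) :=
  [set coset z x | x in layer z].

(* The summand {\a} is None. *)
Definition quotient_sort : Type :=
  option {z : zeros P `\` collapsed & layer_quotient (val z)}.

(* x + I `&` layer z, seen in the summand of index z when there is one, i.e.
   when z is a zero outside collapsed; \a otherwise. *)
Definition quotient_class (z x : P) : quotient_sort :=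
  match pselect ((zeros P `\` collapsed) z), pselect (layer z x) with
  | left hz, left hx =>
      Some (existT (fun z : zeros P `\` collapsed =>
                      set_type (layer_quotient (val z)))
              (exist _ z (mem_set hz))
              (exist _ (coset z x) (mem_set (imageP (coset z) hx))))
  | _, _ => None
  end.

Definition coset_repr (z : P) (c : layer_quotient z) : P :=
  s2val (cid2 (set_valP c)).

(* Operations are computed on chosen representatives; the choice is irrelevant
   when I is an ideal, see quotient_addE, quotient_mulE, quotient_oppE. *)
Definition quotient_op2 (op : P -> P -> P) (u v : quotient_sort) :
    quotient_sort :=
  match u, v with
  | Some (existT z c), Some (existT z' d) =>
      quotient_class (val z * val z') (op (coset_repr c) (coset_repr d))
  | _, _ => None
  end.

Definition quotient_opp (u : quotient_sort) : quotient_sort :=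
  match u with
  | Some (existT z c) => quotient_class (val z) (- coset_repr c)
  | None => None
  end.

Canonical quotient : preMeadow :=
  {| meadow_sort := quotient_sort;
     mzero := quotient_class 0 0;
     mone := quotient_class 0 1;
     merr := None;
     madd := quotient_op2 (@madd P);
     mmul := quotient_op2 (@mmul P);
     mopp := quotient_opp |}.

End Quotient.

Section MeadowTheory.
Variable M : commonMeadow.
Implicit Types x y z u v i j : M.

Let ax := cm_axioms M.
Local Notation inv := (@cm_inv M).

Lemma add0x x : 0 + x = x.
Proof. by rewrite (cm_addC ax) (cm_addx0 ax). Qed.

Lemma mulx1 x : x * 1 = x.
Proof. by rewrite (cm_mulC ax) (cm_mul1x ax). Qed.

Lemma mulDl x y z : (x + y) * z = x * z + y * z.
Proof. by rewrite !(cm_mulC ax _ z) (cm_mulDr ax). Qed.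

Lemma mulCA x y z : x * (y * z) = y * (x * z).
Proof. by rewrite -!(cm_mulA ax) (cm_mulC ax x). Qed.

Lemma addCA x y z : x + (y + z) = y + (x + z).
Proof. by rewrite -!(cm_addA ax) (cm_addC ax x). Qed.

Lemma mul00 : 0 * 0 = 0 :> M.
Proof.
have h := cm_mulDr ax 0 1 0.
by rewrite (cm_addx0 ax) mulx1 add0x in h.
Qed.

Lemma mul0K x : 0 * (0 * x) = 0 * x.
Proof. by rewrite -(cm_mulA ax) mul00. Qed.

Lemma mul0A x y : 0 * (x * y) = (0 * x) * (0 * y).
Proof. by rewrite (cm_mulA ax) (mulCA x) mul0K. Qed.

Lemma addx0K x : x + 0 * x = x.
Proof.
rewrite -[X in X + _](cm_mul1x ax) -mulDl (cm_addx0 ax); exact: cm_mul1x ax x.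
Qed.

Lemma mul0VM x y : (1 + 0 * inv x) * (1 + 0 * inv y) = 1 + 0 * inv (x * y).
Proof.
by rewrite -!(cm_mulxV ax) (cm_invM ax) !(cm_mulA ax) (mulCA (inv x)).
Qed.

Lemma mul0_1D0 x : 0 * (1 + 0 * x) = 0 * x.
Proof. by rewrite (cm_mulDr ax) mul0K mulx1 add0x. Qed.

Lemma add0K x : 0 * x + 0 * x = 0 * x.
Proof. by rewrite -mulDl (cm_addx0 ax). Qed.

Lemma mul0D x y : 0 * (x + y) = (0 * x) * (0 * y).
Proof.
have dist (u v : M) : (1 + 0 * u) * (1 + 0 * v) =
    1 + (0 * u + (0 * v + 0 * (u * v))).
  by rewrite (cm_mulDr ax) mulx1 mulDl (cm_mul1x ax) mul0A !(cm_addA ax).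
have idem (u : M) : 0 * (u * u) = 0 * u.
  have := cm_mulxV ax (1 + 0 * u).
  rewrite (cm_inv1D0 ax) mul0_1D0 => /(congr1 (mmul 0)).
  by rewrite mul0A mul0_1D0 -mul0A.
have absorb : 0 * x + (0 * y + 0 * (x * y)) = 0 * (x * y).
  have := mul0VM (1 + 0 * x) (1 + 0 * y).
  rewrite (cm_invM ax) !(cm_inv1D0 ax) !mul0_1D0 [LHS]dist => /(congr1 (mmul 0)).
  rewrite mul0_1D0 (mul0A (_ + _)) !mul0_1D0 -mul0A !(cm_mulDr ax) !mul0K.
  by rewrite mulx1 !add0x.
rewrite -mul0A -[LHS]idem mulDl !(cm_mulDr ax) !idem (cm_mulC ax y x).
rewrite (cm_addA ax) -(cm_addA ax (0 * (x * y))) add0K.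
by rewrite (cm_addC ax _ (0 * y)).
Qed.

Lemma layer0 : layer (0 : M) 0. Proof. exact: mul00. Qed.

Lemma layer1 : layer (0 : M) 1. Proof. exact: mulx1. Qed.

Lemma layerD z z' x y :
  layer z x -> layer z' y -> layer (z * z') (x + y).
Proof. by move=> <- <-; apply: mul0D. Qed.

Lemma layerM z z' x y :
  layer z x -> layer z' y -> layer (z * z') (x * y).
Proof. by move=> <- <-; apply: mul0A. Qed.

Lemma layerN z x : layer z x -> layer z (- x).
Proof.
move=> <-; rewrite /layer /=.
by rewrite -[LHS](cm_addxN ax) (cm_oppK ax) (cm_addC ax) (cm_addxN ax).
Qed.

Lemma oppE x : - x = (- (1 : M)) * x.
Proof.
have <- : - x + 0 * x = - x by rewrite -(layerN (erefl (0 * x))) addx0K.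
have -> : 0 * x = x + (- (1 : M)) * x.
  rewrite -[x in x + _](cm_mul1x ax) -mulDl (cm_addxN ax).
  by rewrite (cm_mulA ax) (cm_mul1x ax).
rewrite -(cm_addA ax) (cm_addC ax _ x) (cm_addxN ax) -mulDl add0x.
by [].
Qed.

Lemma oppD x y : - (x + y) = - x + - y.
Proof. by rewrite oppE (cm_mulDr ax) -!oppE. Qed.

Lemma layer_zeros z x : layer z x -> zeros M z.
Proof. by move=> <-; exists x. Qed.

Lemma mulzz z x : layer z x -> z * z = z.
Proof.
by move=> <-; rewrite -mul0D (cm_mulDr ax) add0K. Qed.

Variable I : set M.
Hypothesis idI : is_ideal I.

Lemma collapsedP z : zeros M z -> collapsed I z <-> layer z `<=` I.
Proof.
move=> zz; split=> [[_ <-]|sub]; first by move=> x [].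
by split=> //; apply/seteqP; split=> [x []|x zx] //; split=> //; apply: sub.
Qed.

Lemma collapsedM z z' : collapsed I z -> zeros M z' -> collapsed I (z * z').
Proof.
move=> Kz [t _ tz']; have zz := Kz.1; have sub := (collapsedP zz).1 Kz.
have [s _ sz] := zz.
have lzz' : layer (z * z') (s * t) by apply: layerM.
apply/collapsedP; first exact: layer_zeros lzz'.
move=> x zx; rewrite -(addx0K x) zx.
have -> : x + z * z' = (1 + z) * x.
  rewrite mulDl (cm_mul1x ax) -{2}sz (cm_mulA ax) mul0A sz zx.
  by rewrite -(cm_mulA ax) (mulzz sz).
apply: idealM idI _ _ _; apply: sub.
by rewrite /layer /= -sz mul0_1D0.
Qed.

Lemma coset_eq z x i : layer z x -> I i -> layer z i ->
  coset I z (x + i) = coset I z x.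
Proof.
move=> zx Ii zi; have zz := mulzz zx.
apply/seteqP; split=> [_ [j [Ij zj] <-]|_ [j [Ij zj] <-]].
  exists (i + j); last by rewrite (cm_addA ax).
  by split; [apply: idealD|rewrite -zz; apply: layerD].
exists (- i + j); first split.
- by apply: idealD => //; apply: idealN.
- by rewrite -zz; apply: layerD => //; apply: layerN.
rewrite (cm_addA ax) -(cm_addA ax i) (cm_addxN ax) zi -zx -(cm_addA ax).
by rewrite addx0K.
Qed.

Lemma quotient_class_eq z x y : layer z x -> layer z y ->
  coset I z x = coset I z y -> quotient_class I z x = quotient_class I z y.
Proof.
move=> zx zy e; rewrite /quotient_class.
case: pselect => // hz; case: pselect => // hx; case: pselect => // hy.
by congr (Some (existT _ _ _)); apply: val_inj.
Qed.

Lemma quotient_class_add z x i : layer z x -> I i -> layer z i ->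
  quotient_class I z (x + i) = quotient_class I z x.
Proof.
move=> zx Ii zi; apply: quotient_class_eq => //; last exact: coset_eq.
by rewrite -(mulzz zx); apply: layerD.
Qed.

Lemma quotient_class_collapsed z x :
  collapsed I z -> quotient_class I z x = None.
Proof. by move=> Kz; rewrite /quotient_class; case: pselect => // -[]. Qed.

Lemma coset_reprP z x (c : layer_quotient I z) : layer z x ->
  val c = coset I z x ->
  exists i, [/\ I i, layer z i & coset_repr c = x + i].
Proof.
move=> zx e; rewrite /coset_repr; case: cid2 => /= r zr re.
have : coset I z r r.
  exists (0 * r); last exact: addx0K.
  split; last by rewrite /layer /= mul0K.
  by apply: idealM => //; apply: ideal0.
by rewrite re e => -[i [Ii zi] <-]; exists i.
Qed.

Lemma quotient_op2E (op : M -> M -> M) z z' x y :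
  (forall x y, layer z x -> layer z' y -> layer (z * z') (op x y)) ->
  (forall x y i j, layer z x -> layer z' y ->
     I i -> layer z i -> I j -> layer z' j ->
     exists k, [/\ I k, layer (z * z') k & op (x + i) (y + j) = op x y + k]) ->
  layer z x -> layer z' y -> ~ collapsed I z -> ~ collapsed I z' ->
  quotient_op2 op (quotient_class I z x) (quotient_class I z' y) =
  quotient_class I (z * z') (op x y).
Proof.
move=> opl opk zx zy nz nz'; rewrite {1 2}/quotient_class.
case: pselect => [hz|[]]; last by split=> //; apply: layer_zeros zx.
case: pselect => // hx.
case: pselect => [hz'|[]]; last by split=> //; apply: layer_zeros zy.
case: pselect => // hy /=.
set c := exist _ (coset I z x) _; set d := exist _ (coset I z' y) _.
have [i [Ii zi ->]] := @coset_reprP z x c zx erefl.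
have [j [Ij zj ->]] := @coset_reprP z' y d zy erefl.
have [k [Ik zk ->]] := opk x y i j zx zy Ii zi Ij zj.
by apply: quotient_class_add => //; apply: opl.
Qed.

Lemma quotient_addE z z' x y : layer z x -> layer z' y ->
  ~ collapsed I z -> ~ collapsed I z' ->
  quotient_class I z x + quotient_class I z' y =
  quotient_class I (z * z') (x + y).
Proof.
apply: quotient_op2E; first by move=> ? ?; apply: layerD.
move=> {}x {}y i j zx zy Ii zi Ij zj; exists (i + j); split.
- exact: idealD.
- exact: layerD.
by rewrite !(cm_addA ax) (addCA i).
Qed.

Lemma quotient_mulE z z' x y : layer z x -> layer z' y ->
  ~ collapsed I z -> ~ collapsed I z' ->
  quotient_class I z x * quotient_class I z' y =
  quotient_class I (z * z') (x * y).
Proof.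
apply: quotient_op2E; first by move=> ? ?; apply: layerM.
move=> {}x {}y i j zx zy Ii zi Ij zj; exists (j * x + (i * y + i * j)); split.
- by apply: idealD => //; [|apply: idealD => //]; apply: idealM => //.
- have idem : (z * z') * (z * z') = z * z' by apply: mulzz (layerM zx zy).
  rewrite -idem; apply: layerD; first by rewrite (cm_mulC ax j); apply: layerM.
  by rewrite -idem; apply: layerD; apply: layerM.
by rewrite mulDl !(cm_mulDr ax) (cm_mulC ax x j) !(cm_addA ax).
Qed.

Lemma quotient_oppE z x : layer z x -> ~ collapsed I z ->
  - quotient_class I z x =
  quotient_class I z (- x).
Proof.
move=> zx nz; rewrite {1}/quotient_class.
case: pselect => [hz|[]]; last by split=> //; apply: layer_zeros zx.
case: pselect => // hx /=.
set c := exist _ (coset I z x) _.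
have [i [Ii zi ->]] := @coset_reprP z x c zx erefl.
rewrite oppD; apply: quotient_class_add; [exact: layerN|exact: idealN|].
exact: layerN.
Qed.

End MeadowTheory.

(* Main.v *)
(** A sum or product lies in the layer [0] only if both arguments do, so for a
    proper ideal [I] the union of [I] with all the layers other than [M_0] is
    still a proper ideal.  Hence a maximal [I] contains these layers, [M / I] is
    the ring [M_0 / (I `&` M_0)] together with [\a], and this ring is a field:
    for [x] in [M_0] outside [I], the ideal [I + x M] contains [1].
    Conversely, if [x] lies in an ideal [J] containing [I] but not in [I], its
    class is neither [0] nor [\a]; an inverse of this class gives [x * y] in
    [1 + I], and so [1] lies in [J]. *)
Require Import Defs.
From mathcomp Require Import all_boot.
From mathcomp Require Import boolp classical_sets.

Set Implicit Arguments.
Unset Strict Implicit.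
Unset Printing Implicit Defensive.

Local Open Scope classical_set_scope.

(** * Maximal ideals: absorbed layers and inverses modulo the ideal *)

Section CommonMeadow.
Local Open Scope meadow_scope.
Context {M : commonMeadow}.
Implicit Types (x y z : M) (I J : set M).

Let ax := cm_axioms M.

(** Zeros are idempotent for the product, so multiplying the hypothesis by [0 * x] keeps its left
    side and turns its right side into [0 * x]. *)
Lemma mul0_eq0l x y : (0 * x) * (0 * y) = 0 -> 0 * x = 0.
Proof.
move=> h.
have e : (0 * x) * (0 * x) = 0 * x by apply: (@mulzz M _ x).
have : (0 * x) * ((0 * x) * (0 * y)) = 0 by rewrite -(cm_mulA ax) e.
by rewrite h (cm_mulC ax) mul0K.
Qed.

Lemma mul0D_eq0 x y : 0 * (x + y) = 0 -> 0 * x = 0 /\ 0 * y = 0.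
Proof.
by rewrite mul0D => h; split; apply: mul0_eq0l; [|rewrite (cm_mulC ax)]; apply: h.
Qed.

Lemma mul0M_eq0 x y : 0 * (x * y) = 0 -> 0 * x = 0 /\ 0 * y = 0.
Proof. by rewrite mul0A -mul0D; apply: mul0D_eq0. Qed.

Lemma ideal_properP {I} : is_ideal I -> I <> [set: M] <-> ~ I 1.
Proof.
move=> idI; split=> [nI I1|nI1 IT]; last by apply: nI1; rewrite IT.
apply: nI; apply/seteqP; split=> // x _.
by rewrite -(cm_mul1x ax x); apply: idealM.
Qed.

Lemma maximal_ideal_eq I J : is_maximal_ideal I -> is_ideal J -> ~ J 1 ->
  I `<=` J -> J `<=` I.
Proof.
move=> [_ _ maxI] idJ /(ideal_properP idJ) nJ IJ; apply: contrapT => nJI.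
by apply: (maxI J).
Qed.

Lemma maximal_ideal_layer I x : is_maximal_ideal I -> 0 * x <> 0 -> I x.
Proof.
move=> mI nx; have [idI nI _] := mI.
apply: (@maximal_ideal_eq I [set y | I y \/ 0 * y <> 0] mI).
- split.
  + by left; apply: ideal0.
  + move=> y [Iy|ny]; [by left; apply: idealN|right].
    by rewrite (layerN (erefl (0 * y))).
  + move=> y y' [Iy|ny]; last by right=> /mul0D_eq0[].
    by case=> [Iy'|ny']; [left; apply: idealD|right=> /mul0D_eq0[]].
  + by move=> y r [Iy|ny]; [left; apply: idealM|right=> /mul0M_eq0[]].
(* As [1] lies in the layer [0], only membership in [I] could put it in the union. *)
- by case; [apply/ideal_properP|rewrite mulx1].
- by move=> y; left.
- by right.
Qed.

Lemma maximal_ideal_inverse I x : is_maximal_ideal I -> 0 * x = 0 -> ~ I x ->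
  exists r i, [/\ 0 * r = 0, I i, 0 * i = 0 & 1 = x * r + i].
Proof.
move=> mI x0 nIx; have [idI nI _] := mI.
(* Since [x] lies in the layer [0], the choice [r = 0] puts all of [I] into [J]. *)
have x00 : x * 0 = 0 by rewrite (cm_mulC ax).
pose J := [set y | exists r i, I i /\ y = x * r + i].
have IJ : I `<=` J by move=> i Ii; exists 0, i; rewrite x00 add0x.
suff [r [i [Ii e]]] : J 1.
  (* The sum equals [1], which lies in the layer [0]; this forces [r] and [i] into that layer. *)
  have /mul0D_eq0[/mul0M_eq0[_ r0] i0] : 0 * (x * r + i) = 0 by rewrite -e mulx1.
  by exists r, i.
apply: contrapT => nJ1; apply: nIx.
apply: (@maximal_ideal_eq I J mI _ nJ1 IJ); last first.
  by exists 1, 0; rewrite mulx1 (cm_addx0 ax); split=> //; apply: ideal0.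
split.
- by apply: IJ; apply: ideal0.
- move=> _ [r [i [Ii ->]]]; exists (- r), (- i); split; first exact: idealN.
  by rewrite oppD (oppE (x * r)) mulCA -oppE.
- move=> _ _ [r [i [Ii ->]]] [s [j [Ij ->]]]; exists (r + s), (i + j).
  split; first exact: idealD.
  by rewrite (cm_mulDr ax) !(cm_addA ax) (addCA i).
- move=> _ t [r [i [Ii ->]]]; exists (r * t), (i * t).
  by split; [apply: idealM|rewrite mulDl (cm_mulA ax)].
Qed.

End CommonMeadow.

(** * Elements of [M / I], and maximality of [I] from the inverse law *)

Section Quotient.
Local Open Scope meadow_scope.
Context {M : commonMeadow} {I : set M}.
Hypotheses (idI : is_ideal I) (nI : I <> [set: M]).
Implicit Types (x y z : M) (u v w : quotient I).

Let ax := cm_axioms M.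

Lemma quotient_classP u :
  u = \a \/ exists z x, [/\ ~ collapsed I z, layer z x & u = quotient_class I z x].
Proof.
case: u => [[[z hz] [c hc]]|]; last by left.
right; have [zz nz] := set_mem hz; have [x zx xc] := set_mem hc.
exists z, x; split=> //; rewrite /quotient_class.
case: pselect => [hz'|[]//]; case: pselect => [hx|//].
(* The type of the coset depends on the proof stored with [z], so the two proofs are identified
   first. *)
move: hc; rewrite -xc (Prop_irrelevance (mem_set hz') hz) => hc.
by congr (Some (existT _ _ _)); apply: val_inj.
Qed.

Lemma quotient_class_neqa z x :
  ~ collapsed I z -> layer z x -> quotient_class I z x <> \a.
Proof.
move=> nz zx; rewrite /quotient_class; case: pselect => [hz|[]]; last first.
  by split=> //; apply: layer_zeros zx.
by case: pselect.
Qed.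

Lemma quotient_class_inj z x z' y : ~ collapsed I z -> layer z x ->
  quotient_class I z x = quotient_class I z' y ->
  z = z' /\ exists i, [/\ I i, layer z i & x = y + i].
Proof.
move=> nz zx; have := @quotient_class_neqa z x nz zx.
rewrite {1 2}/quotient_class; case: pselect => // hz; case: pselect => // hx _.
rewrite /quotient_class; case: pselect => // hz'; case: pselect => // hy.
(* Forgetting the dependent types turns the equality of classes into equalities of indices and of
   cosets as plain sets. *)
pose f (u : quotient I) := omap
  (fun p : {z : zeros M `\` collapsed I & layer_quotient I (val z)} =>
    (val (projT1 p), val (projT2 p))) u.
move=> /(congr1 f)[] ezz' exy; split=> //.
(* The witness is [x + 0 * x = x], with [0 * x] in [I]. *)
have : coset I z x x.
  exists (0 * x); last exact: addx0K.
  split; last by rewrite /layer /= mul0K.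
  by apply: idealM => //; apply: ideal0.
by rewrite exy -ezz' => -[i [Ii zi] <-]; exists i.
Qed.

(** The layer [0] contains [1], which the proper ideal [I] misses. *)
Lemma not_collapsed0 : ~ collapsed I 0.
Proof.
move=> K0; apply: ((ideal_properP idI).1 nI).
exact: ((collapsedP I K0.1).1 K0) 1 (layer1 M).
Qed.

Lemma quotient_class0_eq0 z x : ~ collapsed I z -> layer z x ->
  quotient_class I z x = 0 -> I x.
Proof.
by move=> nz zx /(quotient_class_inj nz zx)[_ [i [Ii _ ->]]]; rewrite add0x.
Qed.

Lemma quotient_1_neqa : 1 <> \a :> quotient I.
Proof. exact: (quotient_class_neqa not_collapsed0 (layer1 M)). Qed.

Lemma quotient_mulxa u : u * \a = \a. Proof. by case: u => [[]|]. Qed.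

Lemma CIL_maximal_ideal (inv : quotient I -> quotient I) :
  CIL inv -> is_maximal_ideal I.
Proof.
move=> cil; split=> // J idJ /(ideal_properP idJ) nJ [IJ /existsNP[x]].
move=> /not_implyP[Jx nIx]; apply: nJ.
have zx : layer (0 * x) x by [].
have nz : ~ collapsed I (0 * x).
  move=> Kz; apply: nIx.
  exact: ((collapsedP I (layer_zeros zx)).1 Kz) x zx.
have := cil _ _ (quotient_class_neqa nz zx).
move=> /(_ (fun e => nIx (quotient_class0_eq0 nz zx e))).
(* The inverse cannot be [\a], which would make the product [\a] instead of [1]; so it has a
   representative [y]. *)
have [->|[z' [y [nz' zy ->]]]] := quotient_classP (inv (quotient_class I (0 * x) x)).
  by rewrite quotient_mulxa => /esym/quotient_1_neqa.
rewrite (quotient_mulE idI) // => /esym.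
(* Read from the side of [1], whose layer is known not to be collapsed, the equality gives
   [1 = x * y + i] with [i] in [I]. *)
move=> /(quotient_class_inj not_collapsed0 (layer1 M))[_ [i [Ii _ ->]]].
by apply: idealD => //; [apply: idealM|apply: IJ].
Qed.

(** * The quotient by a maximal ideal: a field together with [\a] *)

Section Maximal.
Hypothesis mI : is_maximal_ideal I.

Local Notation q := (quotient_class I 0).

(** All layers other than the layer [0] lie in [I] and collapse, so a single summand remains besides
    [\a]. *)
Lemma maximal_quotientP u : u = \a \/ exists2 x, layer 0 x & u = q x.
Proof.
have [->|[z [x [nz zx ->]]]] := quotient_classP u; [by left|right].
suff z0 : z = 0 by exists x; rewrite -?z0.
apply: contrapT => nz0; apply: nz; apply/collapsedP; first exact: layer_zeros zx.
by move=> y zy; apply: maximal_ideal_layer; rewrite ?zy.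
Qed.

Lemma quotient_add0E x y : layer 0 x -> layer 0 y -> q x + q y = q (x + y).
Proof.
move=> x0 y0; rewrite (quotient_addE idI) ?mul00 //; exact: not_collapsed0.
Qed.

Lemma quotient_mul0E x y : layer 0 x -> layer 0 y -> q x * q y = q (x * y).
Proof.
move=> x0 y0; rewrite (quotient_mulE idI) ?mul00 //; exact: not_collapsed0.
Qed.

Lemma quotient_opp0E x : layer 0 x -> - q x = q (- x).
Proof. by move=> x0; rewrite (quotient_oppE idI) //; exact: not_collapsed0. Qed.

Lemma layer0_add x y : layer 0 x -> layer 0 y -> layer 0 (x + y).
Proof. by move=> x0 y0; rewrite -(mul00 M); apply: layerD. Qed.

Lemma layer0_mul x y : layer 0 x -> layer 0 y -> layer 0 (x * y).
Proof. by move=> x0 y0; rewrite -(mul00 M); apply: layerM. Qed.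

Lemma quotient0E : 0 = q 0. Proof. by []. Qed.
Lemma quotient1E : 1 = q 1. Proof. by []. Qed.
Lemma quotient_addxa u : u + \a = \a. Proof. by case: u => [[]|]. Qed.
Lemma quotient_addax u : \a + u = \a. Proof. by []. Qed.
Lemma quotient_mulax u : \a * u = \a. Proof. by []. Qed.
Lemma quotient_oppa : - \a = \a :> quotient I. Proof. by []. Qed.

(** [aE] settles the cases with [\a]; [qE] moves the operations to representatives in the layer [0],
    and the hint discharges its side conditions. *)
Let aE := (quotient_addxa, quotient_addax, quotient_mulxa, quotient_mulax,
           quotient_oppa).
Let qE := (quotient_add0E, quotient_mul0E, quotient_opp0E).
#[local] Hint Extern 0 (layer _ _) => solve [repeat first
  [ assumption | apply layer0_add | apply layer0_mul | apply layerN
  | apply layer0 | apply layer1 ]] : core.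

Lemma quotient_mulA u v w : (u * v) * w = u * (v * w).
Proof.
have [->|[x x0 ->]] := maximal_quotientP u; first by rewrite !aE.
have [->|[y y0 ->]] := maximal_quotientP v; first by rewrite !aE.
have [->|[z z0 ->]] := maximal_quotientP w; first by rewrite !aE.
by rewrite !qE // (cm_mulA ax).
Qed.

Lemma quotient_mulC u v : u * v = v * u.
Proof.
have [->|[x x0 ->]] := maximal_quotientP u; first by rewrite !aE.
have [->|[y y0 ->]] := maximal_quotientP v; first by rewrite !aE.
by rewrite !qE // (cm_mulC ax).
Qed.

Lemma quotient_mul1x u : 1 * u = u.
Proof.
have [->|[x x0 ->]] := maximal_quotientP u; first by rewrite !aE.
by rewrite quotient1E !qE // (cm_mul1x ax).
Qed.

Lemma quotient_mulx1 u : u * 1 = u.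
Proof. by rewrite quotient_mulC quotient_mul1x. Qed.

Lemma quotient_addx0 u : u + 0 = u.
Proof.
have [->|[x x0 ->]] := maximal_quotientP u; first by rewrite !aE.
by rewrite quotient0E !qE // (cm_addx0 ax).
Qed.

(** The only zeros of the quotient are thus [0] and [\a]; the checks of the inverse axioms rely on
    this. *)
Lemma quotient_mul0x u : u <> \a -> 0 * u = 0.
Proof.
have [->//|[x x0 ->] _] := maximal_quotientP u.
by rewrite quotient0E !qE // x0.
Qed.

Lemma quotient_0_neq1 : 0 <> 1 :> quotient I.
Proof.
move=> /esym/(quotient_class0_eq0 not_collapsed0 (layer1 M)).
exact: ((ideal_properP idI).1 nI).
Qed.

(** A product with [0] is [0] or [\a], and neither is [1]. *)
Lemma quotient_unit_neq0 u v : u * v = 1 -> u <> 0.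
Proof.
move=> h u0; move: h; rewrite u0.
have [->|/quotient_mul0x->] := pselect (v = \a); last exact: quotient_0_neq1.
by rewrite aE => /esym/quotient_1_neqa.
Qed.

Lemma quotient_unit_neqa u v : u * v = 1 -> u <> \a.
Proof. by move=> h ua; move: h; rewrite ua => /esym/quotient_1_neqa. Qed.

Lemma quotient_inverse_exists u : u <> 0 -> u <> \a -> exists v, u * v = 1.
Proof.
have [->//|[x x0 ->] nx _] := maximal_quotientP u.
have nIx : ~ I x.
  move=> Ix; apply: nx; rewrite -(add0x x).
  exact: (quotient_class_add idI (layer0 M)).
have [r [i [r0 Ii i0 e]]] := maximal_ideal_inverse mI x0 nIx.
exists (q r); rewrite quotient_mul0E // quotient1E e.
by rewrite (quotient_class_add idI) //; apply: layer0_mul.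
Qed.

Lemma maximal_ideal_CIL :
  exists inv : quotient I -> quotient I, is_common_meadow inv /\ CIL inv.
Proof.
(* The inverse is chosen pointwise, with the value [\a] at both [0] and [\a]. *)
have /choice[inv invP] u : exists v,
    [\/ u * v = 1, u = 0 /\ v = \a | u = \a /\ v = \a].
  have [->|n0] := pselect (u = 0); first by exists \a; apply: Or32.
  have [->|na] := pselect (u = \a); first by exists \a; apply: Or33.
  by have [v uv] := quotient_inverse_exists n0 na; exists v; apply: Or31.
have cil : CIL inv by move=> u n0 na; case: (invP u) => [|[]|[]].
exists inv; split=> //.
have inv0 : inv 0 = \a.
  by case: (invP 0) => [/quotient_unit_neq0|[]|[]].
have inva : inv \a = \a.
  by case: (invP \a) => [/quotient_unit_neqa|[]|[]].
(* Inverses are unique: [v = v * (u * inv u) = (v * u) * inv u = inv u]. *)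
have invE u v : u * v = 1 -> inv u = v.
  move=> uv; rewrite -[RHS]quotient_mulx1.
  rewrite -(cil u (quotient_unit_neq0 uv) (quotient_unit_neqa uv)).
  by rewrite -quotient_mulA (quotient_mulC v) uv quotient_mul1x.
have inv1 : inv 1 = 1 by apply: invE; rewrite quotient_mul1x.
have inv0M u : inv (0 * u) = \a.
  by have [->|/quotient_mul0x->] := pselect (u = \a); rewrite ?aE.
split.
- move=> u v w; have [->|[x x0 ->]] := maximal_quotientP u; first by rewrite !aE.
  have [->|[y y0 ->]] := maximal_quotientP v; first by rewrite !aE.
  have [->|[z z0 ->]] := maximal_quotientP w; first by rewrite !aE.
  by rewrite !qE // (cm_addA ax).
- move=> u v; have [->|[x x0 ->]] := maximal_quotientP u; first by rewrite !aE.
  have [->|[y y0 ->]] := maximal_quotientP v; first by rewrite !aE.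
  by rewrite !qE // (cm_addC ax).
- exact: quotient_addx0.
- move=> u; have [->|[x x0 ->]] := maximal_quotientP u; first by rewrite !aE.
  by rewrite quotient0E !qE // (cm_addxN ax).
- exact: quotient_mulA.
- exact: quotient_mulC.
- exact: quotient_mul1x.
- move=> u v w; have [->|[x x0 ->]] := maximal_quotientP u; first by rewrite !aE.
  have [->|[y y0 ->]] := maximal_quotientP v; first by rewrite !aE.
  have [->|[z z0 ->]] := maximal_quotientP w; first by rewrite !aE.
  by rewrite !qE // (cm_mulDr ax).
- move=> u; have [->|[x x0 ->]] := maximal_quotientP u; first by rewrite !aE.
  by rewrite !qE // (cm_oppK ax).
(* For invertible [u] the error term [0 * inv u] is [0]; otherwise both sides are [\a]. *)
- move=> u; case: (invP u) => [uv|[_ ->]|[_ ->]]; [|by rewrite !aE..].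
  rewrite uv quotient_mul0x ?quotient_addx0 //.
  by apply: (@quotient_unit_neqa _ u); rewrite quotient_mulC.
(* If both factors are invertible, uniqueness of inverses applies; if not, both sides are [\a]. *)
- move=> u v; case: (invP u) => [uu|[-> ->]|[-> ->]].
  + case: (invP v) => [vv|[-> ->]|[-> ->]]; last by rewrite !aE.
      apply: invE; rewrite quotient_mulA -(quotient_mulA v) (quotient_mulC v).
      by rewrite (quotient_mulA _ v) vv quotient_mulx1.
    by rewrite quotient_mulC inv0M aE.
  + by rewrite inv0M aE.
  + by rewrite !aE.
(* Here [1 + 0 * u] is [\a] or [1], and [inv] fixes both. *)
- move=> u; have [->|/quotient_mul0x->] := pselect (u = \a); first by rewrite !aE.
  by rewrite quotient_addx0.
- exact: inv0.
- exact: quotient_addxa.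
Qed.

End Maximal.
End Quotient.

Theorem proposition5p6 (M : commonMeadow) (I : set M) :
  is_ideal I -> I <> [set: M] ->
  (exists inv : quotient I -> quotient I, is_common_meadow inv /\ CIL inv) <->
  is_maximal_ideal I.
Proof.
move=> idI nI; split=> [[inv [_ cil]]|]; last exact: maximal_ideal_CIL.
exact: CIL_maximal_ideal cil.
Qed.
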